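(* For each integer $k>1$, there exists a symmetric conference matrix in $\mathbb{C}^{(2^k+1)\times(2^k+1)}$.
   Context: A matrix $C\in\mathbb{C}^{n\times n}$ is called a symmetric conference matrix if (i) $C_{ii}=0$ for every $i\in\{1,\dots,n\}$; (ii) $|C_{ij}|=1$ for all $i\neq j$; (iii) $C^\top=C$ (ordinary transpose, not conjugate transpose); and (iv) $CC^*=(n-1)I_n$, where $C^*$ is the conjugate transpose and $I_n$ the $n\times n$ identity matrix. *)

(* Defs.v *)
From HB Require Import structures.
From mathcomp Require Import all_boot all_order all_algebra.
From mathcomp Require Import reals complex.

Set Implicit Arguments.
Unset Strict Implicit.
Unset Printing Implicit Defensive.

Import Order.TTheory GRing.Theory Num.Theory.
Local Open Scope ring_scope.
Local Open Scope complex_scope.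

(* For R : realType, R[i] is the field of complex numbers; its norm `|z| is
   valued in R[i] itself, as a nonnegative real. *)

Definition conjtrmx (R : realType) (m n : nat) (A : 'M[R[i]]_(m, n)) :
    'M[R[i]]_(n, m) :=
  map_mx Num.conj A^T.

Definition symmetric_conference (R : realType) (n : nat) (C : 'M[R[i]]_n) : Prop :=
  [/\ forall i : 'I_n, C i i = 0,
      forall i j : 'I_n, i != j -> `|C i j| = 1,
      C^T = C
    & C *m conjtrmx C = (n%:R - 1)%:M].

(* Main.v *)
Require Import Defs.
From mathcomp Require Import all_boot all_order all_algebra.
From mathcomp Require Import cyclic finfield.
From mathcomp Require Import reals complex.

Set Implicit Arguments.
Unset Strict Implicit.
Unset Printing Implicit Defensive.

Import Order.TTheory GRing.Theory Num.Theory.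
Local Open Scope ring_scope.

(** Let [F] be the field with [q = 2 ^ k] elements and [chi] a nontrivial
    multiplicative character of [F], extended by [chi 0 = 0]; it exists because
    [q - 1 > 1].  Index rows and columns by the projective line of [F] and put
    [chi (det (u, v))] in position [(u, v)].  In characteristic 2 the
    determinant is symmetric, and the scalar product of the rows [u <> v] is, up
    to a factor of modulus 1, the sum of [chi] over [F], which vanishes. *)

Lemma sum_option (V : nmodType) (T : finType) (G : option T -> V) :
  \sum_u G u = G None + \sum_x G (Some x).
Proof.
rewrite (bigD1 None) //=; congr (_ + _).
rewrite (reindex_omap Some id) => [|[x|]] //=.
by apply: eq_bigl => x; rewrite eqxx.
Qed.

Lemma expf_card_pred (F : finFieldType) (x : F) : x != 0 -> x ^+ #|F|.-1 = 1.
Proof.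
move=> x0; apply: (mulfI x0); rewrite -exprS mulr1 prednK ?expf_card //.
exact: ltnW (finNzRing_gt1 F).
Qed.

(** The nonzero elements of [F] are q - 1 distinct roots of X^(q-1) - 1, where q = [#|F|]; this
    forces a primitive root among them. *)
Lemma finField_primitive_root (F : finFieldType) :
  {g : F | (#|F|.-1).-primitive_root g}.
Proof.
have q1 : (0 < #|F|.-1)%N by rewrite -subn1 subn_gt0 finNzRing_gt1.
have /hasP/sig2W[g _ pg] : has (#|F|.-1).-primitive_root (enum (predC1 (0 : F))).
  apply: has_prim_root => //; last 2 first.
  - exact: enum_uniq.
  - by rewrite -cardE cardC1.
  apply/allP => x; rewrite mem_enum => /= x0.
  by apply/unity_rootP; exact: expf_card_pred.
by exists g.
Qed.

(** Any root of 1 + X + ... + X^(n-1) works: this polynomial divides X^n - 1, and its value n at 1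
    is nonzero in characteristic 0. *)
Lemma nontrivial_unity_root_exists (K : numClosedFieldType) (n : nat) :
  (1 < n)%N -> exists2 z : K, z ^+ n = 1 & z != 1.
Proof.
move=> n1; pose p : {poly K} := \poly_(i < n) 1.
have /closed_rootP[z] : size p != 1%N.
  by rewrite size_poly_eq ?oner_eq0 // gtn_eqF.
rewrite /root horner_poly => /eqP pz.
have {}pz : \sum_(i < n) z ^+ i = 0.
  by rewrite -[RHS]pz; apply: eq_bigr => i _; rewrite mul1r.
exists z; first by apply/eqP; rewrite -subr_eq0 subrX1 pz mulr0.
apply/eqP => z1; move/eqP: pz; rewrite z1 (eq_bigr (fun=> 1)) => [|i _].
  by rewrite sumr_const card_ord pnatr_eq0 gtn_eqF // ltnW.
by rewrite expr1n.
Qed.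

Definition nontrivial_mul_char (K : numClosedFieldType) (F : finFieldType)
    (chi : F -> K) : Prop :=
  [/\ chi 0 = 0, {morph chi : x y / x * y},
      forall x, x != 0 -> `|chi x| = 1
    & exists2 g, g != 0 & chi g != 1].

Lemma nontrivial_mul_char_exists (K : numClosedFieldType) (F : finFieldType) :
  (2 < #|F|)%N -> exists chi : F -> K, nontrivial_mul_char chi.
Proof.
move=> q2; have [g pg] := finField_primitive_root F.
have q1 : (1 < #|F|.-1)%N by case: #|F| q2 => [|[]].
have [z zn z1] := nontrivial_unity_root_exists K q1.
have g0 : g != 0 by rewrite (prim_root_eq0 pg) gtn_eqF // ltnW.
have logP x : x != 0 -> exists i, x = g ^+ i.
  move=> x0; have /(prim_rootP pg)[i ->] : x ^+ #|F|.-1 = 1.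
    exact: expf_card_pred.
  by exists i.
(* The discrete logarithm to base [g] carries g^i to z^i; only 0 has no logarithm, and it gets the
   default 0. *)
pose chi (x : F) : K :=
  if [pick i : 'I_(#|F|.-1) | x == g ^+ i] is Some i then z ^+ i else 0.
(* The exponent picked may differ from [i], but only by a multiple of q - 1, and z^(q-1) = 1. *)
have chiE i : chi (g ^+ i) = z ^+ i.
  rewrite /chi; case: pickP => [j /eqP|/(_ (Ordinal (ltn_pmod i (ltnW q1))))].
    move/eqP; rewrite (eq_prim_root_expr pg) => /eqP ij.
    by rewrite -(expr_mod i zn) ij expr_mod.
  by rewrite /= (prim_expr_mod pg) eqxx.
have chi0 : chi 0 = 0.
  by rewrite /chi; case: pickP => // j; rewrite eq_sym expf_eq0 (negPf g0) andbF.
exists chi; split => //.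
- move=> x y; have [->|/logP[i ->]] := eqVneq x 0; first by rewrite mul0r chi0 mul0r.
  have [->|/logP[j ->]] := eqVneq y 0; first by rewrite mulr0 chi0 mulr0.
  by rewrite -exprD !chiE exprD.
- move=> x /logP[i ->]; rewrite chiE normrX; apply/eqP.
  have : `|z| ^+ #|F|.-1 == 1 by rewrite -normrX zn normr1.
  by rewrite pexpr_eq1 ?(ltnW q1)// => /eqP ->; rewrite expr1n.
- by exists g => //; rewrite -(expr1 g) chiE expr1.
Qed.

Section MulChar.
Variables (K : numClosedFieldType) (F : finFieldType) (chi : F -> K).
Hypothesis chiP : nontrivial_mul_char chi.

Lemma mul_char1 : chi 1 = 1.
Proof.
have [_ chiM chiN _] := chiP.
have chi1 : chi 1 != 0 by rewrite -normr_gt0 chiN ?oner_neq0.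
by apply: (mulfI chi1); rewrite -chiM !mulr1.
Qed.

(** On the unit circle conjugation is inversion; at 0 both sides vanish, as [0^-1 = 0]. *)
Lemma mul_char_conj x : (chi x)^* = chi x^-1.
Proof.
have [chi0 chiM chiN _] := chiP.
have [->|x0] := eqVneq x 0; first by rewrite invr0 chi0 conjC0.
have cx0 : chi x != 0 by rewrite -normr_gt0 chiN.
apply: (mulfI cx0); rewrite -chiM divff// mul_char1 -normCK chiN //.
by rewrite expr1n.
Qed.

(** Multiplication by [g] permutes [F], so the sum is unchanged by the factor [chi g], which is not
    1. *)
Lemma sum_mul_char : \sum_x chi x = 0.
Proof.
have [_ chiM _ [g g0 cg]] := chiP.
have : chi g * \sum_x chi x = \sum_x chi x.
  rewrite big_distrr [RHS](reindex_inj (mulfI g0)).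
  by apply: eq_bigr => x _; rewrite chiM.
move/eqP; rewrite -subr_eq0 -{2}[\sum_x _]mul1r -mulrBl mulf_eq0 subr_eq0.
by rewrite (negPf cg) => /eqP.
Qed.

(* The sum misses only the value 1 of [(x + z) / (y + z) = 1 + (x - y) / (y + z)].
   With the convention [0^-1 = 0] the right-hand side is a bijection of [F],
   taking the missing value at the pole [z = - y]. *)
Lemma sum_mul_char_div x y :
  x != y -> \sum_z chi (x + z) * (chi (y + z))^* = -1.
Proof.
move=> xy; have [chi0 chiM _ _] := chiP.
pose h z := 1 + (x - y) * (y + z)^-1.
have h_inj : injective h.
  move=> z t /addrI /(mulfI _) e; apply/(addrI y)/invr_inj/e.
  by rewrite subr_eq0.
have := sum_mul_char; rewrite (reindex_inj h_inj) (bigD1 (- y)) //=.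
rewrite /h subrr invr0 mulr0 addr0 mul_char1 [X in _ -> X = _](bigD1 (- y)) //= subrr.
rewrite chi0 conjC0 mulr0 add0r => /eqP; rewrite addrC addr_eq0 => /eqP <-.
apply: eq_bigr => z zy; rewrite mul_char_conj -chiM.
have yz : y + z != 0 by rewrite addrC addr_eq0.
by rewrite -[1 in RHS](divff yz) -mulrDl [y + z + _]addrC addrA subrK.
Qed.

(* [Some x] stands for the point (x : 1) and [None] for the point (1 : 0). *)
Definition paley_entry (u v : option F) : K :=
  match u, v with
  | Some x, Some y => chi (x + y)
  | None, None => 0
  | _, _ => 1
  end.

Lemma paley_entryC u v : paley_entry u v = paley_entry v u.
Proof. by case: u v => [x|] [y|] //=; rewrite addrC. Qed.

Hypothesis F2 : 2%N \in [pchar F].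

Lemma paley_entry_diag u : paley_entry u u = 0.
Proof. by have [chi0 _ _ _] := chiP; case: u => [x|] //=; rewrite addrr_pchar2. Qed.

Lemma paley_entry_norm u v : u != v -> `|paley_entry u v| = 1.
Proof.
have [_ _ chiN _] := chiP.
case: u v => [x|] [y|] //= uv; rewrite ?normr1 ?eqxx // in uv *.
by rewrite chiN // addr_eq0 oppr_pchar2.
Qed.

(** The column [None] is split off. For distinct finite points it contributes 1, cancelling the -1
    of [sum_mul_char_div]; for a finite point against [None] it contributes 0, and a full sum of
    [chi] or its conjugate remains. *)
Lemma paley_row_orthogonal u v :
  \sum_w paley_entry u w * (paley_entry v w)^* = #|F|%:R *+ (u == v).
Proof.
have [chi0 chiM _ _] := chiP.
have sum_shift x : \sum_z chi (x + z) = 0.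
  by rewrite -[RHS]sum_mul_char [RHS](reindex_inj (addrI x)).
have sum_conj x : \sum_z (chi (x + z))^* = 0 by rewrite -rmorph_sum sum_shift rmorph0.
rewrite sum_option; case: u v => [x|] [y|] /=.
- rewrite (inj_eq Some_inj) rmorph1 mulr1; case: eqVneq => [->|xy].
    rewrite (bigD1 y) //= addrr_pchar2 // chi0 mul0r add0r.
    (* The q - 1 remaining terms are squared moduli equal to 1; the column [None] completes them to
       q. *)
    rewrite (eq_bigr (fun=> 1)) => [|z zy].
      rewrite sumr_const (@cardC1 F y) mulr1n -mulrS prednK //.
      exact: ltnW (finNzRing_gt1 F).
    rewrite mul_char_conj -chiM divff ?mul_char1 // addrC addr_eq0 oppr_pchar2 //.
  by rewrite sum_mul_char_div // subrr mulr0n.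
- rewrite conjC0 mulr0 add0r.
  by under eq_bigr do rewrite rmorph1 mulr1; rewrite sum_shift.
- by rewrite mul0r add0r; under eq_bigr do rewrite mul1r; rewrite sum_conj.
- rewrite mul0r add0r; under eq_bigr do rewrite rmorph1 mulr1.
  by rewrite sumr_const mulr1n.
Qed.

End MulChar.

Local Open Scope complex_scope.

Theorem theorem9 (R : realType) (k : nat) (hk : (1 < k)%N) :
  exists C : 'M[R[i]]_(2 ^ k + 1)%N, symmetric_conference C.
Proof.
have [F F2 cardF] := pPrimePowerField (isT : prime 2) (ltnW hk).
have [chi chiP] : exists chi : F -> R[i], nontrivial_mul_char chi.
  (* Here k > 1 enters, through 2 < 2^2 <= 2^k. *)
  apply: nontrivial_mul_char_exists; rewrite cardF.
  exact: leq_trans (ltn_expl 2 _) (leq_pexp2l _ hk).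
have card_pts : (2 ^ k + 1)%N = #|{: option F}| by rewrite card_option cardF addn1.
pose pt (i : 'I_(2 ^ k + 1)) : option F := enum_val (cast_ord card_pts i).
have pt_inj : injective pt by move=> i j /enum_val_inj /cast_ord_inj.
have pt_bij : bijective pt.
  by apply: inj_card_bij => //; rewrite card_ord -card_pts.
exists (\matrix_(i, j) paley_entry chi (pt i) (pt j)); split.
- by move=> i; rewrite mxE paley_entry_diag.
- by move=> i j ij; rewrite mxE paley_entry_norm // (inj_eq pt_inj).
- by apply/matrixP => i j; rewrite !mxE paley_entryC.
- apply/matrixP => i j; rewrite !mxE natrD addrK -[X in X%:R]cardF -(inj_eq pt_inj).
  rewrite -(paley_row_orthogonal chiP) // (reindex pt) /=; last exact: onW_bij.
  by apply: eq_bigr => l _; rewrite !mxE.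
Qed.
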